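(* The recursive algorithm NTEST described in the context correctly decides whether a given real square matrix is an N-matrix, in $O(2^n)$ time. That is, for every positive integer $n$ and every $A\in\mathbb{R}^{n\times n}$, $\mathrm{NTEST}(A)$ returns $1$ if $A$ is an N-matrix and returns $0$ otherwise; and there is a constant $C>0$ such that for every $n$ and every $A\in\mathbb{R}^{n\times n}$, the computation of $\mathrm{NTEST}(A)$ uses at most $C\,2^n$ operations.
   Context: A real $n\times n$ matrix $A$ is an N-matrix if every principal minor $\det A[\gamma]$, $\emptyset\neq\gamma\subseteq\{1,\dots,n\}$, is negative, and a P-matrix if every such principal minor is positive. Here $A[\gamma]$ is the submatrix of $A$ with rows and columns indexed by $\gamma$. The algorithms PTEST and NTEST take a real $n\times n$ matrix $A=[a_{ij}]$ ($n\ge 1$) and return $0$ or $1$. When $n\geq 2$ and $a_{11}\ne0$, let $b$ be the $(n-1)\times(n-1)$ submatrix of $A$ obtained by deleting the first row and column, and let $c=b-\frac{1}{a_{11}}\,uv$, where $u=(a_{21},\dots,a_{n1})^T$ and $v=(a_{12},\dots,a_{1n})$. $\mathrm{PTEST}(A)$: if $a_{11}\le 0$, return $0$; else if $n=1$, return $1$; else compute $b$ and $c$ and return $\mathrm{PTEST}(b)\wedge\mathrm{PTEST}(c)$. $\mathrm{NTEST}(A)$: if $a_{11}\ge 0$, return $0$; else if $n=1$, return $1$; else compute $b$ and $c$ and return $\mathrm{NTEST}(b)\wedge\mathrm{PTEST}(c)$. Here $\wedge$ is logical AND on $\{0,1\}$. Operations counted are real arithmetic operations ($+,-,\times,/$),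 comparisons of a real number with $0$, copying of an entry, and logical operations, each at unit cost, with exact real arithmetic. *)

(* Defs.v *)
From HB Require Import structures.
From mathcomp Require Import all_boot all_order all_algebra.
From mathcomp Require Import reals.

Set Implicit Arguments.
Unset Strict Implicit.
Unset Printing Implicit Defensive.

Import Order.TTheory GRing.Theory Num.Theory.
Local Open Scope ring_scope.

Definition principal_submx (R : realType) (n : nat) (A : 'M[R]_n)
    (gamma : {set 'I_n}) : 'M[R]_#|gamma| :=
  mxsub (fun i : 'I_#|gamma| => enum_val i) (fun j : 'I_#|gamma| => enum_val j) A.

Definition N_matrix (R : realType) (n : nat) (A : 'M[R]_n) : Prop :=
  forall gamma : {set 'I_n},
    gamma != set0 -> \det (principal_submx A gamma) < 0.

(* Computations carry the number of unit-cost operations they perform; only   *)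
(* the primitives built with [unit_op] add to this count.                     *)
Record counted (T : Type) : Type := Counted { result : T; cost : nat }.

Definition ret (T : Type) (x : T) : counted T := Counted x 0%N.

Definition bind (T U : Type) (e : counted T) (f : T -> counted U) : counted U :=
  Counted (result (f (result e))) (cost e + cost (f (result e)))%N.

Notation "'let*' x := e1 'in' e2" := (bind e1 (fun x => e2))
  (at level 200, x name, e1 at level 200, e2 at level 200, right associativity).

Definition unit_op (T : Type) (x : T) : counted T := Counted x 1%N.

Definition op_sub (R : realType) (x y : R) : counted R := unit_op (x - y).
Definition op_mul (R : realType) (x y : R) : counted R := unit_op (x * y).
Definition op_div (R : realType) (x y : R) : counted R := unit_op (x / y).
Definition op_le0 (R : realType) (x : R) : counted bool := unit_op (x <= 0).
Definition op_ge0 (R : realType) (x : R) : counted bool := unit_op (0 <= x).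
Definition op_copy (R : realType) (x : R) : counted R := unit_op x.
Definition op_and (x y : bool) : counted bool := unit_op (x && y).

(* Double loop filling an m x p array, running [f i j] once for each entry.   *)
Definition fill_mx (R : realType) (m p : nat)
    (f : 'I_m -> 'I_p -> counted R) : counted 'M[R]_(m, p) :=
  Counted (\matrix_(i, j) result (f i j))
          (\sum_(i < m) \sum_(j < p) cost (f i j))%N.

Definition compute_b (R : realType) (m : nat) (A : 'M[R]_m.+2) :
    counted 'M[R]_m.+1 :=
  fill_mx (fun i j => op_copy (A (lift ord0 i) (lift ord0 j))).

Definition compute_c (R : realType) (m : nat) (A : 'M[R]_m.+2)
    (b : 'M[R]_m.+1) : counted 'M[R]_m.+1 :=
  let* u := fill_mx (fun (i : 'I_m.+1) (_ : 'I_1) =>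
                       op_copy (A (lift ord0 i) ord0)) in
  let* v := fill_mx (fun (_ : 'I_1) (j : 'I_m.+1) =>
                       op_copy (A ord0 (lift ord0 j))) in
  let* s := op_div 1 (A ord0 ord0) in
  fill_mx (fun i j =>
    let* uv_ij := op_mul (u i ord0) (v ord0 j) in
    let* t := op_mul s uv_ij in
    op_sub (b i j) t).

(* Matrices have size n.+1, so that sizes are positive and the case n = 0 is  *)
(* that of 1 x 1 matrices. Both recursive calls are always executed: the      *)
(* conjunction is not short-circuited.                                        *)
Fixpoint PTEST (R : realType) (n : nat) (A : 'M[R]_n.+1) {struct n} :
    counted bool :=
  let* a11_le0 := op_le0 (A ord0 ord0) in
  if a11_le0 then ret false else
  match n return 'M[R]_n.+1 -> counted bool with
  | 0%N => fun _ => ret true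
  | m.+1 => fun A =>
      let* b := compute_b A in
      let* c := compute_c A b in
      let* x := PTEST b in
      let* y := PTEST c in
      op_and x y
  end A.

Fixpoint NTEST (R : realType) (n : nat) (A : 'M[R]_n.+1) {struct n} :
    counted bool :=
  let* a11_ge0 := op_ge0 (A ord0 ord0) in
  if a11_ge0 then ret false else
  match n return 'M[R]_n.+1 -> counted bool with
  | 0%N => fun _ => ret true
  | m.+1 => fun A =>
      let* b := compute_b A in
      let* c := compute_c A b in
      let* x := NTEST b in
      let* y := PTEST c in
      op_and x y
  end A.

(* Main.v *)
Require Import Defs.
From HB Require Import structures.
From mathcomp Require Import all_boot all_order all_algebra.
From mathcomp Require Import reals.
From mathcomp Require Import perm zify ring.

Set Implicit Arguments.
Unset Strict Implicit.
Unset Printing Implicit Defensive.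

Import Order.TTheory GRing.Theory Num.Theory.
Local Open Scope ring_scope.

(** Pivoting on a nonzero entry a = a_11 relates the principal minors of A to
    those of the trailing submatrix b and of the Schur complement c of a: for a
    set delta of indices greater than 1, det A[delta] = det b[delta] when 1 is
    left out ([minor_trailing]), and det A[{1} u delta] = a det c[delta] when 1
    is put in ([minor_schur]).  Every index set has one of these two shapes, so
    the signs of the principal minors of A are determined by the sign of a and
    the signs of the principal minors of b and c ([all_minors_pivot]).  When
    a > 0 multiplication by a keeps signs, hence A is a P-matrix iff b and c
    are; when a < 0 it reverses them, hence A is an N-matrix iff b is an
    N-matrix and c is a P-matrix.  Correctness of both tests follows by
    induction on the size.

    For the cost, a call on a matrix of size k + 1 performs at most
    4k^2 + 2k + 3 operations besides two recursive calls at size k.  The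
    overhead is absorbed by a quadratic correction term that makes the bound
    on the total exactly double at each step ([cost_bounded_step]), which
    leaves a multiple of 2^k. *)

(** * Principal minors *)

Section Minors.
Variable R : realType.

Definition minor n (A : 'M[R]_n) (gamma : {set 'I_n}) : R :=
  \det (principal_submx A gamma).

(** Two injective enumerations of the same index set differ by a permutation,
    which acts on rows and columns alike, so its sign cancels.  This frees
    minors from the particular enumeration [enum_val]. *)
Lemma det_mxsub_codom n k l (A : 'M[R]_n) (f : 'I_k -> 'I_n) (g : 'I_l -> 'I_n) :
    injective f -> injective g -> f @: setT = g @: setT ->
  \det (mxsub f f A) = \det (mxsub g g A).
Proof.
move=> f_inj g_inj eq_fg.
have eq_kl : k = l.
  by rewrite -(card_ord k) -(card_ord l) -!cardsT -(card_imset _ f_inj) eq_fg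
             card_imset.
subst l.
have fg i : exists j, g j == f i.
  have /imsetP[j _ ->] : f i \in g @: setT by rewrite -eq_fg imset_f.
  by exists j.
pose h i := xchoose (fg i).
have hE i : g (h i) = f i by apply/eqP/(xchooseP (fg i)).
have h_inj : injective h by move=> i j eq_h; apply: f_inj; rewrite -!hE eq_h.
have -> : mxsub f f A = row_perm (perm h_inj) (col_perm (perm h_inj) (mxsub g g A)).
  by apply/matrixP=> i j; rewrite !mxE !permE !hE.
rewrite row_permE col_permE !det_mulmx !det_perm odd_permV.
by rewrite mulrC -mulrA -expr2 sqrr_sign mulr1.
Qed.

Lemma enum_val_setT n (gamma : {set 'I_n}) :
  (fun i : 'I_#|gamma| => enum_val i) @: setT = gamma.
Proof.
apply/setP=> i; apply/imsetP/idP=> [[j _ ->]|gi]; first exact: enum_valP.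
by exists (enum_rank_in gi i); rewrite ?enum_rankK_in.
Qed.

Lemma minor_mxsub n k (A : 'M[R]_n) (gamma : {set 'I_n}) (f : 'I_k -> 'I_n) :
  injective f -> f @: setT = gamma -> minor A gamma = \det (mxsub f f A).
Proof.
move=> f_inj f_gamma; apply: det_mxsub_codom => //; first exact: enum_val_inj.
by rewrite f_gamma enum_val_setT.
Qed.

Lemma minor_set0 n (A : 'M[R]_n) : minor A set0 = 1.
Proof.
rewrite (@minor_mxsub _ 0 _ _ (widen_ord (leq0n n))) ?det_mx00 //; first by case.
by apply/setP=> i; rewrite inE; apply/imsetP=> -[[]].
Qed.

(** * Pivoting on the first entry *)

Definition trailing m (A : 'M[R]_m.+1) : 'M[R]_m :=
  \matrix_(i, j) A (lift ord0 i) (lift ord0 j).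

Definition schur m (A : 'M[R]_m.+1) : 'M[R]_m :=
  \matrix_(i, j) (A (lift ord0 i) (lift ord0 j)
    - 1 / A ord0 ord0 * (A (lift ord0 i) ord0 * A ord0 (lift ord0 j))).

(** Gaussian elimination of the first column factors A as a unipotent lower
    triangular matrix times a block upper triangular one. *)
Lemma det_schur m (A : 'M[R]_m.+1) :
  A ord0 ord0 != 0 -> \det A = A ord0 ord0 * \det (schur A).
Proof.
move=> a_neq0; set a := A ord0 ord0 in a_neq0 *.
pose u : 'cV[R]_m := \col_i (A (lift ord0 i) ord0).
pose v : 'rV[R]_m := \row_j (A ord0 (lift ord0 j)).
pose L : 'M[R]_(1 + m) := block_mx 1%:M 0 (a^-1 *: u) 1%:M.
pose U : 'M[R]_(1 + m) := block_mx a%:M v 0 (schur A).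
have A_LU : A = L *m U.
  rewrite mulmx_block !mul1mx !mul0mx !addr0.
  rewrite -[A in LHS](@submxK _ 1 m 1 m).
  have l0 i : lshift m (i : 'I_1) = ord0 by rewrite ord1; apply/val_inj.
  apply: (f_equal4 (@block_mx R 1 m 1 m));
    apply/matrixP=> i j; rewrite !mxE ?l0 ?ord1 ?rshift1 //.
  - by rewrite big_ord1 !mxE eqxx mulr1n mulrAC mulVf ?mul1r.
  - rewrite big_ord1 !mxE -/a; ring.
have det_L : \det L = 1 by rewrite det_lblock !det1 mulr1.
have det_U : \det U = a * \det (schur A) by rewrite det_ublock det_scalar1.
by rewrite {1}A_LU det_mulmx det_L det_U mul1r.
Qed.

(** The index set, enumerated with the pivot first. *)
Definition cons_ord k m (f : 'I_k -> 'I_m) (i : 'I_k.+1) : 'I_m.+1 :=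
  oapp (lift ord0 \o f) ord0 (unlift ord0 i).

Lemma cons_ord0 k m (f : 'I_k -> 'I_m) : cons_ord f ord0 = ord0.
Proof. by rewrite /cons_ord unlift_none. Qed.

Lemma cons_ordS k m (f : 'I_k -> 'I_m) i :
  cons_ord f (lift ord0 i) = lift ord0 (f i).
Proof. by rewrite /cons_ord liftK. Qed.

Lemma cons_ord_inj k m (f : 'I_k -> 'I_m) : injective f -> injective (cons_ord f).
Proof.
move=> f_inj i j.
case: (unliftP ord0 i) => [i'|] ->; case: (unliftP ord0 j) => [j'|] ->;
  rewrite ?cons_ord0 ?cons_ordS //.
by move=> /lift_inj/f_inj ->.
Qed.

Lemma cons_ord_setT k m (f : 'I_k -> 'I_m) :
  cons_ord f @: setT = ord0 |: lift ord0 @: (f @: setT).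
Proof.
apply/setP=> i; apply/imsetP/setU1P=> [[j _ ->]|[->|/imsetP[_ /imsetP[j _ ->] ->]]].
- case: (unliftP ord0 j) => [j'|] ->; rewrite ?cons_ord0 ?cons_ordS; last by left.
  by right; rewrite !imset_f.
- by exists ord0; rewrite ?cons_ord0.
- by exists (lift ord0 j); rewrite ?cons_ordS.
Qed.

Lemma minor_trailing m (A : 'M[R]_m.+1) (delta : {set 'I_m}) :
  minor A (lift ord0 @: delta) = minor (trailing A) delta.
Proof.
rewrite (@minor_mxsub _ _ A _ (lift ord0 \o fun i : 'I_#|delta| => enum_val i)).
- by congr (\det _); apply/matrixP=> i j; rewrite !mxE.
- exact/inj_comp/enum_val_inj/lift_inj.
- by rewrite imset_comp enum_val_setT.
Qed.

(** Taking the Schur complement of the pivot commutes with restriction to an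
    index set that contains the pivot. *)
Lemma minor_schur m (A : 'M[R]_m.+1) (delta : {set 'I_m}) :
    A ord0 ord0 != 0 ->
  minor A (ord0 |: lift ord0 @: delta) = A ord0 ord0 * minor (schur A) delta.
Proof.
move=> a_neq0; pose f := fun i : 'I_#|delta| => enum_val i.
rewrite (@minor_mxsub _ _ A _ (cons_ord f)).
- rewrite det_schur ?mxE ?cons_ord0 //; congr (_ * \det _).
  by apply/matrixP=> i j; rewrite !mxE !cons_ord0 !cons_ordS.
- exact/cons_ord_inj/enum_val_inj.
- by rewrite cons_ord_setT enum_val_setT.
Qed.

(** The two shapes of index sets to which [minor_trailing] and [minor_schur]
    apply are exhaustive. *)
Lemma set_ordS m (gamma : {set 'I_m.+1}) :
  let delta := lift ord0 @^-1: gamma in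
  gamma = if ord0 \in gamma then ord0 |: lift ord0 @: delta
          else lift ord0 @: delta.
Proof.
move=> delta; apply/setP=> i.
have mem_lift j : (lift ord0 j \in lift ord0 @: delta) = (lift ord0 j \in gamma).
  by rewrite mem_imset ?inE //; exact: lift_inj.
have ord0_notin : (ord0 \in lift ord0 @: delta) = false.
  by apply/imsetP=> -[j _] /eqP; rewrite (negPf (neq_lift _ _)).
by case: (unliftP ord0 i) => [j|] ->; case: ifP => g0; rewrite ?inE ?mem_lift ?g0.
Qed.

(** The sign condition is a parameter so that one statement about pivoting
    serves both P-matrices and N-matrices. *)
Definition all_minors (S : pred R) n (A : 'M[R]_n) : Prop :=
  forall gamma : {set 'I_n}, gamma != set0 -> S (minor A gamma).

Lemma eq_all_minors (S S' : pred R) n (A : 'M[R]_n) :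
  S =1 S' -> all_minors S A <-> all_minors S' A.
Proof. by move=> eqS; split=> SA gamma /SA; rewrite eqS. Qed.

(** For the empty delta, [minor_schur] gives the minor a itself, which accounts
    for the separate condition on the pivot. *)
Lemma all_minors_pivot (S : pred R) m (A : 'M[R]_m.+1) :
    A ord0 ord0 != 0 ->
  all_minors S A <->
  [/\ S (A ord0 ord0), all_minors S (trailing A)
    & all_minors (fun x => S (A ord0 ord0 * x)) (schur A)].
Proof.
move=> a_neq0; split=> [SA|[Sa Sb Sc] gamma gamma_neq0].
- have set1_neq0 (delta : {set 'I_m}) : ord0 |: lift ord0 @: delta != set0.
    by apply/set0Pn; exists ord0; rewrite setU11.
  split=> [|delta delta_neq0|delta _].
  + have := SA _ (set1_neq0 set0).
    by rewrite minor_schur // minor_set0 mulr1.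
  + by rewrite -minor_trailing; apply: SA; rewrite imset_eq0.
  + by rewrite -minor_schur //; exact: SA.
- move: gamma_neq0; rewrite (set_ordS gamma); set delta := _ @^-1: _.
  case: ifP => _; last by rewrite imset_eq0 minor_trailing; exact: Sb.
  rewrite minor_schur // => _.
  have [->|/Sc//] := eqVneq delta set0.
  by rewrite minor_set0 mulr1.
Qed.

(** The pivot is itself a principal minor; this justifies rejecting a matrix on
    the sign of the pivot alone, including the case of a zero pivot. *)
Lemma all_minors_corner (S : pred R) m (A : 'M[R]_m.+1) :
  all_minors S A -> S (A ord0 ord0).
Proof.
have <- : minor A [set ord0] = A ord0 ord0.
  rewrite (@minor_mxsub _ 1 A _ (fun=> ord0)) ?det_mx11 ?mxE //.
    by move=> i j; rewrite !ord1.
  apply/setP=> i; rewrite inE; apply/imsetP/eqP=> [[]//|->]; by exists ord0.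
by apply; apply/set0Pn; exists ord0; rewrite inE.
Qed.

Lemma all_minors_ord0 (S : pred R) (A : 'M[R]_0) : all_minors S A.
Proof. by move=> gamma /set0Pn[[]]. Qed.

(** * Correctness *)

Definition P_matrix n (A : 'M[R]_n) : Prop := all_minors (fun x => 0 < x) A.

Lemma P_matrix_pivot m (A : 'M[R]_m.+1) :
  P_matrix A <->
  [/\ 0 < A ord0 ord0, P_matrix (trailing A) & P_matrix (schur A)].
Proof.
have [a_gt0|a_le0] := boolP (0 < A ord0 ord0); last first.
  by split=> [/all_minors_corner /=|[]//]; rewrite (negPf a_le0).
have eqS x : (0 < A ord0 ord0 * x) = (0 < x) by rewrite pmulr_rgt0.
rewrite /P_matrix all_minors_pivot ?gt_eqF //.
have eq_schur := eq_all_minors (schur A) eqS.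
by split=> -[? ? /eq_schur ?]; split.
Qed.

(** The Schur complement of a negative pivot carries the opposite signs, which
    is why P-matrices enter the recursion for N-matrices. *)
Lemma N_matrix_pivot m (A : 'M[R]_m.+1) :
  N_matrix A <->
  [/\ A ord0 ord0 < 0, N_matrix (trailing A) & P_matrix (schur A)].
Proof.
have N_def n (B : 'M[R]_n) : N_matrix B <-> all_minors (fun x => x < 0) B by [].
have [a_lt0|a_ge0] := boolP (A ord0 ord0 < 0); last first.
  by split=> [/N_def/all_minors_corner /=|[]//]; rewrite (negPf a_ge0).
have eqS x : (A ord0 ord0 * x < 0) = (0 < x) by rewrite nmulr_rlt0.
rewrite !N_def all_minors_pivot ?lt_eqF //.
have eq_schur := eq_all_minors (schur A) eqS.
by split=> -[? ? /eq_schur ?]; split.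
Qed.

Lemma result_compute_c m (A : 'M[R]_m.+2) :
  result (compute_c A (trailing A)) = schur A.
Proof. by apply/matrixP=> i j; rewrite !mxE. Qed.

Lemma PTESTE m (A : 'M[R]_m.+2) :
  result (PTEST A) = ~~ (A ord0 ord0 <= 0)
    && (result (PTEST (trailing A)) && result (PTEST (schur A))).
Proof. by rewrite -result_compute_c /=; case: ifP. Qed.

Lemma result_PTEST n (A : 'M[R]_n.+1) : result (PTEST A) <-> P_matrix A.
Proof.
elim: n A => [|n IHn] A; rewrite P_matrix_pivot ltNge.
- rewrite /=; case: ifP => _ /=; first by split=> // -[].
  by split=> // _; split=> //; exact: all_minors_ord0.
- rewrite PTESTE; split=> [/and3P[a /IHn Pb /IHn Pc] //|[a Pb Pc]].
  by apply/and3P; split=> //; apply: (IHn _).2.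
Qed.

Lemma NTESTE m (A : 'M[R]_m.+2) :
  result (NTEST A) = ~~ (0 <= A ord0 ord0)
    && (result (NTEST (trailing A)) && result (PTEST (schur A))).
Proof. by rewrite -result_compute_c /=; case: ifP. Qed.

Lemma result_NTEST n (A : 'M[R]_n.+1) : result (NTEST A) <-> N_matrix A.
Proof.
elim: n A => [|n IHn] A; rewrite N_matrix_pivot ltNge.
- rewrite /=; case: ifP => _ /=; first by split=> // -[].
  split=> // _; split=> //; last exact: all_minors_ord0.
  exact: (@all_minors_ord0 (fun x => x < 0)).
- rewrite NTESTE; split=> [/and3P[a /IHn Nb /result_PTEST Pc] //|[a Nb Pc]].
  by apply/and3P; split=> //; [apply: (IHn _).2 | apply: (result_PTEST _).2].
Qed.

(** * Cost *)

Lemma cost_fill_mx m p (f : 'I_m -> 'I_p -> counted R) k :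
  (forall i j, cost (f i j) = k) -> cost (fill_mx f) = (m * p * k)%N.
Proof.
move=> f_k; rewrite /= (eq_bigr (fun=> (p * k)%N)) => [|i _].
  by rewrite sum_nat_const card_ord mulnA.
by rewrite (eq_bigr (fun=> k)) // sum_nat_const card_ord.
Qed.

Lemma cost_compute_b m (A : 'M[R]_m.+2) : cost (compute_b A) = (m.+1 ^ 2)%N.
Proof. by rewrite /compute_b (cost_fill_mx (k := 1)) // muln1. Qed.

Lemma cost_compute_c m (A : 'M[R]_m.+2) (b : 'M[R]_m.+1) :
  cost (compute_c A b) = (3 * m.+1 ^ 2 + 2 * m.+1 + 1)%N.
Proof.
have cost_bind T U (e : counted T) (f : T -> counted U) :
  cost (bind e f) = (cost e + cost (f (result e)))%N by [].
rewrite /compute_c !cost_bind (cost_fill_mx (k := 1)) // (cost_fill_mx (k := 1)) //.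
by rewrite (cost_fill_mx (k := 3)) //=; lia.
Qed.

(** The quadratic q(n) = 4n^2 + 18n + 31 solves
    2q(n) - q(n + 1) = 4(n + 1)^2 + 2(n + 1) + 3, whose right-hand side is the
    overhead of one call on a matrix of size n + 2, so the bound on cost + q
    doubles when the size increases by one; its initial value, at size 1, is
    1 + q(0) = 32. *)
Definition cost_bounded (n t : nat) : Prop :=
  (t + (4 * n ^ 2 + 18 * n + 31) <= 32 * 2 ^ n)%N.

Lemma cost_bounded_step n x y :
    cost_bounded n x -> cost_bounded n y ->
  cost_bounded n.+1
    (1 + (n.+1 ^ 2 + ((3 * n.+1 ^ 2 + 2 * n.+1 + 1) + (x + (y + 1)))))%N.
Proof. by rewrite /cost_bounded (expnS 2 n) -!mulnn; lia. Qed.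

(** The case of an early return after a single comparison. *)
Lemma cost_bounded1 n : cost_bounded n 1.
Proof.
elim: n => [//|n IHn]; move: IHn; rewrite /cost_bounded (expnS 2 n) -!mulnn; lia.
Qed.

Lemma cost_PTESTE m (A : 'M[R]_m.+2) :
  cost (PTEST A) = (1 + if (A ord0 ord0 <= 0)%R then 0 else
    cost (compute_b A) + (cost (compute_c A (trailing A)) +
      (cost (PTEST (trailing A)) + (cost (PTEST (schur A)) + 1))))%N.
Proof. by rewrite -result_compute_c /=; case: ifP. Qed.

Lemma cost_PTEST n (A : 'M[R]_n.+1) : cost_bounded n (cost (PTEST A)).
Proof.
elim: n A => [|n IHn] A; first by rewrite /=; case: ifP.
rewrite cost_PTESTE; case: ifP => _; first exact: cost_bounded1.
rewrite cost_compute_b cost_compute_c.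
apply: cost_bounded_step; exact: IHn.
Qed.

Lemma cost_NTESTE m (A : 'M[R]_m.+2) :
  cost (NTEST A) = (1 + if (0 <= A ord0 ord0)%R then 0 else
    cost (compute_b A) + (cost (compute_c A (trailing A)) +
      (cost (NTEST (trailing A)) + (cost (PTEST (schur A)) + 1))))%N.
Proof. by rewrite -result_compute_c /=; case: ifP. Qed.

Lemma cost_NTEST n (A : 'M[R]_n.+1) : cost_bounded n (cost (NTEST A)).
Proof.
elim: n A => [|n IHn] A; first by rewrite /=; case: ifP.
rewrite cost_NTESTE; case: ifP => _; first exact: cost_bounded1.
rewrite cost_compute_b cost_compute_c.
by apply: cost_bounded_step; [exact: IHn | exact: cost_PTEST].
Qed.

End Minors.

Theorem mainTheorem2 (R : realType) :
  (forall (n : nat) (A : 'M[R]_n.+1),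
     (N_matrix A -> result (NTEST A) = true) /\
     (~ N_matrix A -> result (NTEST A) = false)) /\
  (exists C : R, 0 < C /\
     forall (n : nat) (A : 'M[R]_n.+1),
       (cost (NTEST A))%:R <= C * 2 ^+ n.+1).
Proof.
split=> [n A|].
  split=> [/result_NTEST //|notN].
  by apply/negbTE/negP => /result_NTEST.
(* The bound 32 * 2^n at size n + 1 is 16 * 2^(n + 1). *)
exists 16%:R; split=> [|n A]; first by rewrite ltr0n.
rewrite -natrX -natrM ler_nat expnS mulnA.
exact: leq_trans (leq_addr _ _) (cost_NTEST A).
Qed.
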